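(* Let $n \in \mathbb{N}$, $n \geq 2$, and let $\mathcal{B}_{n}$ be the Brauer monoid of degree $n$. Then the maximal subsemigroups of $\mathcal{B}_{n}$ are precisely: (a) $(\mathcal{B}_{n} \setminus \mathcal{S}_{n}) \cup U$, where $U$ is a maximal subgroup of $\mathcal{S}_{n}$ (type (M5)); and (b) $\mathcal{B}_{n} \setminus \{\alpha \in \mathcal{B}_{n} : \operatorname{rank}(\alpha) = n - 2\}$ (type (M1)). In particular, for $n \geq 2$, there are $s_{n} + 1$ maximal subsemigroups of $\mathcal{B}_{n}$, where $s_{n}$ denotes the number of maximal subgroups of the symmetric group of degree $n$.
   Context: $\mathbb{N}=\{1,2,3,\ldots\}$. A maximal subsemigroup of a semigroup $S$ (maximal subgroup of a group) is a proper subsemigroup (subgroup) not contained in any other proper one. A partition of degree $n$ is an equivalence relation on $\{1,\ldots,n\}\cup\{1',\ldots,n'\}$; its classes are called blocks; a block is transverse if it contains both unprimed and primed points. The rank of a partition is its number of transverse blocks. The product $\alpha\beta$: replace each $i'$ by $i''$ in $\alpha$ to get $\alpha'$, replace each $i$ by $i''$ in $\beta$ to get $\beta'$; let $(\alpha\beta)'$ be the smallest equivalence on $\{1,\ldots,n\}\cup\{1',\ldots,n'\}\cup\{1'',\ldots,n''\}$ containing $\alpha'\cup\beta'$; then $\alpha\beta$ is the restriction of $(\alpha\beta)'$ to $\{1,\ldots,n\}\cup\{1',\ldots,n'\}$. $\mathcal{B}_n$ is the monoid, under this product, of partitions of degree $n$ all of whose blocks have size exactly $2$. $\mathcal{S}_n$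 denotes its group of units: the partitions all of whose blocks have the form $\{i,j'\}$, a copy of the symmetric group of degree $n$. Types: a maximal subsemigroup $M$ of a finite monoid $S$ arises from the $\mathscr{J}$-class $J$ if $S\setminus M\subseteq J$; when $J$ is regular, $M$ has type (M1) if $M\cap J=\varnothing$, and (M5) if $M\cap J$ meets every $\mathscr{H}$-class of $J$. *)

(* Defs.v *)
From HB Require Import structures.
From mathcomp Require Import all_boot all_fingroup all_solvable.

Set Implicit Arguments.
Unset Strict Implicit.
Unset Printing Implicit Defensive.

Local Open Scope group_scope.

(* [inl i] is the unprimed point i and [inr i] the primed point i';
   the points 1, ..., n are numbered 0, ..., n - 1. *)
Definition point (n : nat) : finType := ('I_n + 'I_n)%type.

(* An equivalence relation on the points, given by its set of classes. *)
Record diagram (n : nat) := Diagram {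
  blocks :> {set {set point n}};
  blocksP : partition blocks [set: point n]
}.

HB.instance Definition _ n := [isSub for @blocks n].
HB.instance Definition _ n := [Finite of diagram n by <:].

Definition conn n (a : diagram n) : rel (point n) :=
  fun p q => q \in pblock a p.

(* The equivalence relation of [a], transported along a relabelling [f] of the
   points. *)
Definition place n (V : finType) (f : point n -> V) (a : diagram n) : rel V :=
  fun x y => [exists p, exists q, [&& conn a p q, x == f p & y == f q]].

(* The points i, i' and i'': the last is [inr i], the others are
   [inl (inl i)] and [inl (inr i)]. *)
Definition point3 (n : nat) : finType := (point n + 'I_n)%type.

Definition upper n (p : point n) : point3 n :=
  match p with inl i => inl (inl i) | inr i => inr i end.

Definition lower n (p : point n) : point3 n :=
  match p with inl i => inr i | inr i => inl (inr i) end.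

Definition stack n (a b : diagram n) : rel (point3 n) :=
  relU (place (@upper n) a) (place (@lower n) b).

(* [connect] is the reflexive transitive closure; as [stack a b] is symmetric,
   this is the smallest equivalence containing it. *)
Definition prod_rel n (a b : diagram n) : rel (point n) :=
  fun p q => connect (stack a b) (inl p) (inl q).

Section DiagramMonoid.
Variable n : nat.
Implicit Types (a b c : diagram n) (p q : point n).

Lemma conn_equiv a : equivalence_rel (conn a).
Proof. by move=> x y z; apply: (pblock_equivalence (blocksP a)). Qed.

Lemma conn_refl a : reflexive (conn a).
Proof. by move=> x; case: (conn_equiv a x x x). Qed.

Lemma conn_sym a : symmetric (conn a).
Proof.
have sub x y : conn a x y -> conn a y x.
  by move=> h; have [_ /(_ h) <-] := conn_equiv a x y x; apply: conn_refl.
by move=> x y; apply/idP/idP; apply: sub.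
Qed.

Lemma diagram_eq a b : conn a =2 conn b -> a = b.
Proof.
move=> e; apply: val_inj => /=.
rewrite -(equivalence_partition_pblock (blocksP a)).
rewrite -(equivalence_partition_pblock (blocksP b)).
apply: eq_imset => x; apply/setP => y; rewrite !inE /=.
exact: e.
Qed.

Lemma place_sym (V : finType) (f : point n -> V) a : symmetric (place f a).
Proof.
move=> x y; apply/existsP/existsP => -[p /existsP[q /and3P[h hx hy]]];
by exists q; apply/existsP; exists p; rewrite conn_sym h hx hy.
Qed.

Lemma placeP (V : finType) (f : point n -> V) a x y :
  reflect (exists p q, [/\ conn a p q, x = f p & y = f q]) (place f a x y).
Proof.
apply: (iffP existsP) => [[p /existsP[q /and3P[h /eqP-> /eqP->]]]|].
  by exists p, q.
by move=> [p [q [h -> ->]]]; exists p; apply/existsP; exists q; rewrite h !eqxx.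
Qed.

Lemma stack_sym a b : symmetric (stack a b).
Proof. by move=> x y; rewrite /stack /= place_sym [X in _ || X]place_sym. Qed.

Lemma prod_rel_equiv a b :
  {in [set: point n] & &, equivalence_rel (prod_rel a b)}.
Proof.
move=> x y z _ _ _; split; first exact: connect0.
rewrite /prod_rel => h.
by rewrite (same_connect (sym_connect_sym (stack_sym a b)) h).
Qed.

Definition diagram_mul a b : diagram n :=
  Diagram (equivalence_partitionP (@prod_rel_equiv a b)).

Lemma conn_mul a b : conn (diagram_mul a b) =2 prod_rel a b.
Proof.
move=> p q; rewrite /conn /=.
by rewrite (pblock_equivalence_partition (@prod_rel_equiv a b)) ?inE.
Qed.

Definition index_of p : 'I_n := match p with inl i => i | inr i => i end.

Definition diagram_one : diagram n :=
  Diagram (preim_partitionP index_of [set: point n]).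

Lemma conn_one p q : conn diagram_one p q = (index_of p == index_of q).
Proof.
rewrite /conn /= /preim_partition pblock_equivalence_partition ?inE //.
by move=> x y z _ _ _; split=> // /eqP->.
Qed.

Lemma connect_min (V : finType) (e : rel V) (P : V -> Prop) x y :
  P x -> (forall u v, e u v -> P u -> P v) -> connect e x y -> P y.
Proof.
move=> Px H /connectP[s]; elim: s x Px => [|z s IH] x Px /=; first by move=> _ ->.
by case/andP=> exz; apply: IH; apply: H exz Px.
Qed.

Lemma connect_place (V : finType) (e : rel V) (f : point n -> V) a p q :
  subrel (place f a) e -> conn a p q -> connect e (f p) (f q).
Proof. by move=> s h; apply/connect1/s/placeP; exists p, q. Qed.

(* Replacing, inside a larger graph, a placed product by its two factors. *)
Lemma connect_expand (V V' : finType) (i : V -> V') (t : point3 n -> V')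
    (f k : point n -> V) a b c :
  injective i -> injective t ->
  (forall p, t (inl p) = i (f p)) -> (forall m v, t (inr m) <> i v) ->
  forall x y,
  connect (relU (place f (diagram_mul a b)) (place k c)) x y =
  connect (relU (relU (place (t \o @upper n) a) (place (t \o @lower n) b))
                (place (i \o k) c)) (i x) (i y).
Proof.
move=> inj_i inj_t tf tm x y.
set S := relU _ (place k c); set W := relU (relU _ _) _.
have sa : subrel (place (t \o @upper n) a) W by move=> u v h; rewrite /W /= h.
have sb : subrel (place (t \o @lower n) b) W.
  by move=> u v h; rewrite /W /= h orbT.
have sc : subrel (place (i \o k) c) W by move=> u v h; rewrite /W /= h !orbT.
have sab : subrel (place f (diagram_mul a b)) S by move=> u v h; rewrite /S /= h.
have skc : subrel (place k c) S by move=> u v h; rewrite /S /= h orbT.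
have stW u v : connect (stack a b) u v -> connect W (t u) (t v).
  apply: (@connect_min _ (stack a b) (fun v => connect W (t u) (t v))) => //.
  move=> w z /orP[] /placeP[p [q [h -> ->]]] uw; apply: connect_trans uw _.
    exact: (connect_place sa h).
  exact: (connect_place sb h).
apply/idP/idP.
  apply: (@connect_min _ S (fun v => connect W (i x) (i v))) => //.
  move=> u v /orP[] /placeP[p [q [h -> ->]]] xu; apply: connect_trans xu _.
    by rewrite -!tf; apply: stW; rewrite conn_mul in h.
  exact: (connect_place sc h).
pose P (w : V') :=
  (exists2 v, w = i v & connect S x v) \/
  (exists u p, [/\ w = t u, connect S x (f p)
                 & connect (stack a b) (inl p) u]).
have PW w : P w -> forall v, w = i v -> connect S x v.
  move=> [[v -> h] v' /inj_i <- //|[u [p [-> h1 h2]]] v].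
  case: u h2 => [q h2|m _ /tm//]; rewrite tf => /inj_i <-.
  by apply: connect_trans h1 (connect_place sab _); rewrite conn_mul.
have PT w : P w -> forall u, w = t u ->
    exists2 p, connect S x (f p) & connect (stack a b) (inl p) u.
  move=> [[v -> h] u e|[u [p [-> h1 h2]]] u' /inj_t <-]; last by exists p.
  case: u e => [p|m /esym/tm//]; rewrite tf => /inj_i ev; subst v.
  by exists p.
move=> h; apply: (PW (i y)) => //; move: h.
apply: connect_min; first by left; exists x.
move=> u v /orP[/orP[]|] /placeP[p [q [h -> ->]]] Pu.
- have [r h1 h2] := PT _ Pu _ erefl; right; exists (upper q), r; split=> //.
  by apply: connect_trans h2 (connect_place _ h) => ? ? e; rewrite /stack /= e.
- have [r h1 h2] := PT _ Pu _ erefl; right; exists (lower q), r; split=> //.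
  apply: connect_trans h2 (connect_place _ h) => ? ? e.
  by rewrite /stack /= e orbT.
- left; exists (k q) => //; apply: connect_trans (PW _ Pu _ erefl) _.
  exact: (connect_place skc h).
Qed.

Lemma diagram_mulA : associative diagram_mul.
Proof.
move=> a b c; apply: diagram_eq => p q; rewrite !conn_mul /prod_rel.
pose i1 (x : point3 n) : point n + point n := match x with
  inl (inl j) => inl (inl j) | inr j => inl (inr j) | inl (inr j) => inr (inr j)
  end.
pose t1 (x : point3 n) : point n + point n := match x with
  inl (inl j) => inl (inr j) | inr j => inr (inl j) | inl (inr j) => inr (inr j)
  end.
pose i2 (x : point3 n) : point n + point n := match x with
  inl (inl j) => inl (inl j) | inr j => inr (inl j) | inl (inr j) => inr (inr j)
  end.
pose t2 (x : point3 n) : point n + point n := match x with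
  inl (inl j) => inl (inl j) | inr j => inl (inr j) | inl (inr j) => inr (inl j)
  end.
have E1 := @connect_expand _ _ i1 t1 (@lower n) (@upper n) b c a.
have E2 := @connect_expand _ _ i2 t2 (@upper n) (@lower n) a b c.
transitivity (connect (relU (place (@lower n) (diagram_mul b c))
                            (place (@upper n) a)) (inl p) (inl q)).
  by apply: eq_connect => x y; rewrite /stack /= orbC.
rewrite E1 ?[RHS]E2; first last;
  try by [move=> []//|move=> [[j|j]|j] [[k|k]|k] //= [->]|move=> m [[j|j]|j]].
have -> : i1 (inl p) = i2 (inl p) by [].
have -> : i1 (inl q) = i2 (inl q) by [].
have eq_place (f g : point n -> point n + point n) d :
  f =1 g -> place f d =2 place g d.
  move=> e x y; apply: eq_existsb => u; apply: eq_existsb => v.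
  by rewrite !e.
apply: eq_connect => x y /=.
rewrite (@eq_place (t1 \o @upper n) (t2 \o @lower n)); last by case.
rewrite (@eq_place (t1 \o @lower n) (i2 \o @lower n)); last by case.
rewrite (@eq_place (i1 \o @upper n) (t2 \o @upper n)); last by case.
by rewrite orbC orbA.
Qed.

Lemma diagram_mul1 : left_id diagram_one diagram_mul.
Proof.
move=> b; apply: diagram_eq => p q; rewrite conn_mul /prod_rel.
pose g (x : point3 n) : point n := match x with
  inl (inl j) => inl j | inr j => inl j | inl (inr j) => inr j end.
have gl r : g (lower r) = r by case: r.
have gi r : g (upper r) = inl (index_of r) by case: r.
have up r : connect (stack diagram_one b) (inl r) (lower r).
  case: r => j /=; last exact: connect0.
  apply: (@connect_place _ _ (@upper n) diagram_one (inl j) (inr j)).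
    by move=> ? ? e; rewrite /stack /= e.
  by rewrite conn_one.
apply/idP/idP => [|h].
  suff H y : connect (stack diagram_one b) (inl p) y -> conn b p (g y).
    by move/H; case: q.
  apply: (@connect_min _ _ (fun y => conn b p (g y))).
    by case: p => j; apply: conn_refl.
  move=> u v /orP[] /placeP[r [s [e -> ->]]].
    by rewrite !gi; move: e; rewrite conn_one => /eqP->.
  by rewrite !gl => h; have [_ ->] := conn_equiv b p r s.
apply: connect_trans (up p) _; apply: (@connect_trans _ _ (lower q)).
  by apply: (connect_place _ h) => ? ? e; rewrite /stack /= e orbT.
rewrite (sym_connect_sym (stack_sym _ _)); exact: up.
Qed.

Lemma diagram_1mul : right_id diagram_one diagram_mul.
Proof.
move=> b; apply: diagram_eq => p q; rewrite conn_mul /prod_rel.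
pose g (x : point3 n) : point n := match x with
  inl (inl j) => inl j | inr j => inr j | inl (inr j) => inr j end.
have gl r : g (upper r) = r by case: r.
have gi r : g (lower r) = inr (index_of r) by case: r.
have up r : connect (stack b diagram_one) (inl r) (upper r).
  case: r => j /=; first exact: connect0.
  apply: (@connect_place _ _ (@lower n) diagram_one (inr j) (inl j)).
    by move=> ? ? e; rewrite /stack /= e orbT.
  by rewrite conn_one.
apply/idP/idP => [|h].
  suff H y : connect (stack b diagram_one) (inl p) y -> conn b p (g y).
    by move/H; case: q.
  apply: (@connect_min _ _ (fun y => conn b p (g y))).
    by case: p => j; apply: conn_refl.
  move=> u v /orP[] /placeP[r [s [e -> ->]]].
    by rewrite !gl => h; have [_ ->] := conn_equiv b p r s.
  by rewrite !gi; move: e; rewrite conn_one => /eqP->.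
apply: connect_trans (up p) _; apply: (@connect_trans _ _ (upper q)).
  by apply: (connect_place _ h) => ? ? e; rewrite /stack /= e.
rewrite (sym_connect_sym (stack_sym _ _)); exact: up.
Qed.

End DiagramMonoid.

HB.instance Definition _ n := isMonoid.Build (diagram n)
  (@diagram_mulA n) (@diagram_mul1 n) (@diagram_1mul n).

Section Brauer.
Variable n : nat.
Implicit Types (a : diagram n) (B : {set point n}) (S M J U G : {set diagram n}).

Definition transverse B :=
  [exists i : 'I_n, inl i \in B] && [exists i : 'I_n, inr i \in B].

Definition diagram_rank a := #|[set B in blocks a | transverse B]|.

(* The Brauer monoid, as a submonoid of the monoid of all partitions. *)
Definition brauer : {set diagram n} :=
  [set a | [forall B in blocks a, #|B| == 2]].

Definition brauer_units : {set diagram n} :=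
  [set a | [forall B in blocks a,
     exists i : 'I_n, exists j : 'I_n, B == [set inl i; inr j]]].

Definition mul_stable M := [forall x in M, forall y in M, x * y \in M].

Definition subsemigroup S M := [&& M != set0, M \subset S & mul_stable M].

Definition maximal_subsemigroup S M :=
  maxset (fun N => subsemigroup S N && (N \proper S)) M.

Definition subgroup G U :=
  [&& U \subset G, 1 \in U, mul_stable U
    & [forall x in U, exists y in U, (x * y == 1) && (y * x == 1)]].

Definition maximal_subgroup G U :=
  maxset (fun V => subgroup G V && (V \proper G)) U.

(* Green's relations of a submonoid [S]; as 1 is in [S], the principal ideals
   generated by [x] are S x, x S and S x S. *)
Definition greenL S : rel (diagram n) :=
  fun x y => [set s * x | s : diagram n in S] == [set s * y | s : diagram n in S].

Definition greenR S : rel (diagram n) :=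
  fun x y => [set x * s | s : diagram n in S] == [set y * s | s : diagram n in S].

Definition greenH S : rel (diagram n) :=
  fun x y => greenL S x y && greenR S x y.

Definition greenJ S : rel (diagram n) :=
  fun x y => [set s * x * t | s : diagram n in S, t : diagram n in S]
             == [set s * y * t | s : diagram n in S, t : diagram n in S].

Definition J_classes S := equivalence_partition (greenJ S) S.

Definition H_classes S := equivalence_partition (greenH S) S.

Definition regular_class S J := [forall x in J, exists s in S, x * s * x == x].

Definition arises_from S M J :=
  [&& maximal_subsemigroup S M, J \in J_classes S & S :\: M \subset J].

Definition type_M1 S M := exists J,
  [/\ arises_from S M J, regular_class S J & M :&: J = set0].

Definition type_M5 S M := exists J,
  [/\ arises_from S M J, regular_class S J
    & forall H, H \in H_classes S -> H \subset J -> M :&: H != set0].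

End Brauer.

Definition num_maximal_subgroups_Sym (n : nat) : nat :=
  #|[set G : {group 'S_n} | maximal G [set: 'S_n]]|.

(* Main.v *)
Require Import Defs.
From mathcomp Require Import all_boot all_fingroup all_solvable.
From mathcomp Require Import zify.

Set Implicit Arguments.
Unset Strict Implicit.
Unset Printing Implicit Defensive.

Local Open Scope group_scope.

(** Write S for the Brauer monoid and E for its group of units.  In a Brauer
    diagram every point has exactly one partner.  Everything rests on two
    multiplication rules, in which products become relabellings of one factor.
    Right multiplication by the diagram of a permutation permutes the primed
    points ([mul_perm]).  Right multiplication by the hook diagram
    [hook k l], whose only non-transverse blocks are {k, l} and {k', l'}, swaps
    the partner of k' with l' ([mul_hook]).

    The set of unprimed (primed) points lying in non-transverse blocks,
    [horiz true a] ([horiz false a]), measures the rank: its cardinal is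
    n - rank a.  A product only enlarges [horiz true] of its left factor and
    [horiz false] of its right factor.  Read backwards, the hook rule says that
    a Brauer diagram with a block {k', l'} is b * [hook k l] with b of larger
    rank ([split_hook]).  By induction, E and the hooks generate S
    ([brauer_hook_ind]); this yields in turn that S is closed under products.
    It also follows that any two diagrams of rank n - 2 differ by units on the
    left and on the right ([corank2_equiv]), so that E together with any
    single diagram of rank n - 2 generates S ([brauer_generated]).

    Let M be a maximal subsemigroup.  If M contains E, it therefore contains no
    diagram of rank n - 2, and S without these diagrams is a proper
    subsemigroup, because there is no rank n - 1.  If M does not contain E,
    then adding to M the ideal of non-units gives a proper subsemigroup, so M
    contains all non-units; the intersection of M with E is closed under
    products, and nonempty since otherwise 1 could be added to M, hence it is a
    subgroup, and it is maximal because M is.  The converse arguments are the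
    same, and the count follows from the isomorphism of E with the symmetric
    group. *)

(** * Diagrams, partners and relabelling *)

Section Diagrams.
Variable n : nat.
Implicit Types (a b c : diagram n) (p q : point n) (i j k l : 'I_n).

Lemma conn_trans a : transitive (conn a).
Proof. by move=> y x z xy yz; have [_ ->] := conn_equiv a x y z. Qed.

Lemma conn_in_block a (B : {set point n}) p q :
  B \in blocks a -> p \in B -> conn a p q = (q \in B).
Proof.
move=> aB pB; have /and3P[_ tI _] := blocksP a.
by rewrite /conn (def_pblock tI aB pB).
Qed.

Lemma pblock_blocks a p : pblock a p \in blocks a.
Proof.
by have /and3P[/eqP cov _ _] := blocksP a; apply: pblock_mem; rewrite cov inE.
Qed.

Lemma relabel_equiv (f : point n -> point n) a :
  {in [set: point n] & &,
    equivalence_rel (fun p q => conn a (f p) (f q))}.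
Proof. by move=> x y z _ _ _; apply: conn_equiv. Qed.

(** The pullback of the equivalence relation of [a] along [f]: when [f] is
    bijective, the diagram [a] with its points renamed by the inverse of [f]. *)
Definition relabel (f : point n -> point n) a : diagram n :=
  Diagram (equivalence_partitionP (relabel_equiv f a)).

Lemma conn_relabel f a p q : conn (relabel f a) p q = conn a (f p) (f q).
Proof.
rewrite [LHS]/conn /=.
by rewrite (pblock_equivalence_partition (relabel_equiv f a)) ?inE.
Qed.

Lemma brauerP a :
  reflect (forall p, #|[set q | conn a p q]| = 2) (a \in brauer n).
Proof.
have e p : [set q | conn a p q] = pblock a p by apply/setP => q; rewrite inE.
rewrite inE; apply: (iffP forall_inP) => [h p | h B aB].
  by rewrite e; apply/eqP/h/pblock_blocks.
have /and3P[_ tI B0] := blocksP a.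
have [p pB] : exists p, p \in B.
  by apply/set0Pn; apply: contraNneq B0 => <-.
by rewrite -(def_pblock tI aB pB) -e h.
Qed.

Lemma relabel_brauer (f : point n -> point n) a :
  injective f -> (relabel f a \in brauer n) = (a \in brauer n).
Proof.
move=> f_inj.
have e p : #|[set q | conn (relabel f a) p q]| = #|[set q | conn a (f p) q]|.
  rewrite -(card_preimset [set q | conn a (f p) q] f_inj).
  by apply: eq_card => q; rewrite !inE conn_relabel.
have [g fK gK] := injF_bij f_inj.
apply/brauerP/brauerP => h p; last by rewrite e.
by rewrite -(gK p) -e.
Qed.

Lemma conn1 p q : conn 1 p q = (index_of p == index_of q).
Proof. exact: conn_one. Qed.

Lemma one_brauer : (1 : diagram n) \in brauer n.
Proof.
apply/brauerP => p.
have -> : [set q | conn 1 p q] = [set inl (index_of p); inr (index_of p)].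
  apply/setP => -[j|j]; rewrite !inE conn1.
    by rewrite orbF eq_sym.
  by rewrite /= eq_sym.
by rewrite cards2.
Qed.

(** The other point of the block of [p] when that block has two points; when
    [p] is alone in its block, the default value is [p] itself. *)
Definition partner a p : point n := odflt p [pick q | conn a p q && (q != p)].

Lemma conn_partner a p : conn a p (partner a p).
Proof. by rewrite /partner; case: pickP => [q /andP[]|_] //=; apply: conn_refl. Qed.

Lemma partnerN a p : a \in brauer n -> partner a p != p.
Proof.
move=> /brauerP/(_ p) h; rewrite /partner; case: pickP => [q /andP[]|no] //=.
suff s : [set q | conn a p q] \subset [set p].
  by move/subset_leq_card: s; rewrite h cards1.
apply/subsetP => q; rewrite !inE => hq; have := no q.
by rewrite hq /= => /negbFE.
Qed.

Lemma connE a p q : a \in brauer n -> conn a p q = (q == p) || (q == partner a p).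
Proof.
move=> Ba; have /brauerP/(_ p) h := Ba.
have e : [set p; partner a p] = [set q | conn a p q].
  apply/eqP; rewrite eqEcard h cards2 eq_sym partnerN // andbT.
  by apply/subsetP => r; rewrite !inE => /orP[] /eqP->;
    rewrite ?conn_refl ?conn_partner.
by have := in_set2 q p (partner a p); rewrite e inE.
Qed.

Lemma partner_eq a p q : a \in brauer n -> conn a p q -> q != p -> partner a p = q.
Proof. by move=> Ba; rewrite connE // => /orP[->//|/eqP->]. Qed.

(** As all blocks have size 2, inclusion of the equivalence relations is enough
    for equality. *)
Lemma brauer_eq a b : a \in brauer n -> b \in brauer n ->
  subrel (conn a) (conn b) -> a = b.
Proof.
move=> Ba Bb s; apply: diagram_eq => p q; rewrite !connE //.
congr (_ || (_ == _)); apply/esym/partner_eq => //; last exact: partnerN.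
exact/s/conn_partner.
Qed.

(** The point i ([u = true]) or i' ([u = false]). *)
Definition side (u : bool) i : point n := if u then inl i else inr i.

Lemma sideE u i v j : (side u i == side v j) = (u == v) && (i == j).
Proof. by case: u; case: v. Qed.

Lemma sideP p : exists u i, p = side u i.
Proof. by case: p => i; [exists true, i|exists false, i]. Qed.

(** * The rank and the non-transverse blocks *)

(** For a Brauer diagram, the indices of the points on side [u] that lie in
    non-transverse blocks. *)
Definition horiz (u : bool) a : {set 'I_n} :=
  [set i | [exists j, (j != i) && conn a (side u i) (side u j)]].

Lemma horizP u a i :
  reflect (exists2 j, j != i & conn a (side u i) (side u j)) (i \in horiz u a).
Proof. by rewrite inE; apply: (iffP exists_inP). Qed.

Lemma horiz_partner u a i : a \in brauer n -> i \notin horiz u a ->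
  exists j, partner a (side u i) = side (~~ u) j.
Proof.
move=> Ba; have [v [j e]] := sideP (partner a (side u i)) => h; exists j.
rewrite e; congr side; apply/eqP; apply: contraR h => vu.
have {vu}uv : v = u by case: (u) (v) vu => -[].
subst v; apply/horizP; exists j.
  by have := partnerN (side u i) Ba; rewrite e sideE eqxx.
by rewrite -e conn_partner.
Qed.

Lemma transverseE u (B : {set point n}) :
  transverse B = [exists i, side u i \in B] && [exists i, side (~~ u) i \in B].
Proof. by rewrite /transverse; case: u => //=; rewrite andbC. Qed.

(** The transverse blocks correspond to the points of either side that are not
    in [horiz]. *)
Lemma rank_horiz u a : a \in brauer n -> diagram_rank a + #|horiz u a| = n.
Proof.
move=> Ba; pose f i := pblock a (side u i).
have mem i : side u i \in f i by have := conn_refl a (side u i).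
have -> : diagram_rank a = #|f @: ~: horiz u a|.
  apply: eq_card => B; rewrite !inE (transverseE u).
  apply/andP/imsetP => [[aB /andP[/existsP[i iB] /existsP[j jB]]]|[i]].
    have cB q := conn_in_block q aB iB.
    have ep : partner a (side u i) = side (~~ u) j.
      apply: partner_eq => //; first by rewrite cB.
      by rewrite sideE; case: (u).
    exists i; last first.
      by apply/setP => q; rewrite -cB.
    rewrite !inE; apply/existsP => -[k /andP[ki]].
    rewrite connE // ep !sideE eqxx (negPf ki) /=.
    by case: (u).
  rewrite inE => hi ->; split; first exact: pblock_blocks.
  apply/andP; split; apply/existsP; first by exists i.
  have [j e] := horiz_partner Ba hi.
  by exists j; rewrite -e; apply: conn_partner.
rewrite card_in_imset => [|i j]; first by rewrite addnC cardsC card_ord.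
rewrite !inE => hi hj e; apply/eqP; apply: contraNT hi => ij.
apply/existsP; exists j; rewrite eq_sym ij /=.
by have := mem j; rewrite -e.
Qed.

Lemma card_horiz u v a : a \in brauer n -> #|horiz u a| = #|horiz v a|.
Proof.
move=> Ba; apply/eqP; rewrite -(eqn_add2l (diagram_rank a)).
by rewrite !rank_horiz.
Qed.

Lemma horiz_mul_up a b : horiz true a \subset horiz true (a * b).
Proof.
apply/subsetP => i /horizP[j ji h]; apply/horizP; exists j => //.
rewrite conn_mul /prod_rel.
by apply: (connect_place (f := @upper n) _ h) => ? ? e; rewrite /stack /= e.
Qed.

Lemma horiz_mul_lo a b : horiz false b \subset horiz false (a * b).
Proof.
apply/subsetP => i /horizP[j ji h]; apply/horizP; exists j => //.
rewrite conn_mul /prod_rel.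
by apply: (connect_place (f := @lower n) _ h) => ? ? e; rewrite /stack /= e orbT.
Qed.

(** * Multiplication by permutation diagrams and by hooks *)

Lemma stack_upper a b p q :
  conn a p q -> connect (stack a b) (upper p) (upper q).
Proof. by apply: connect_place => ? ? e; rewrite /stack /= e. Qed.

Lemma stack_lower a b p q :
  conn b p q -> connect (stack a b) (lower p) (lower q).
Proof. by apply: connect_place => ? ? e; rewrite /stack /= e orbT. Qed.

Lemma stack_connect_sym a b : connect_sym (stack a b).
Proof. exact/sym_connect_sym/stack_sym. Qed.

(** A criterion for computing a product: [g] labels each vertex of the stacked
    graph by a point of its [c]-class, so that no edge leaves a [c]-class, while
    [cP] says that [c]-related points are joined in the graph. *)
Lemma mul_eq a b c (g : point3 n -> point n) :
  (forall p, g (inl p) = p) ->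
  (forall p q, conn a p q -> conn c (g (upper p)) (g (upper q))) ->
  (forall p q, conn b p q -> conn c (g (lower p)) (g (lower q))) ->
  (forall p q, conn c p q -> connect (stack a b) (inl p) (inl q)) ->
  a * b = c.
Proof.
move=> gl ga gb cP; apply: diagram_eq => p q; rewrite conn_mul.
apply/idP/idP; last exact: cP.
move=> pq; suff H y : connect (stack a b) (inl p) y -> conn c p (g y).
  by rewrite -[q]gl; apply: H.
apply: (@connect_min _ _ (fun y => conn c p (g y))) => [|u v].
  by rewrite gl conn_refl.
by move=> /orP[] /placeP[r [s [h -> ->]]] hp; apply: (conn_trans hp); auto.
Qed.

(** The permutation [s] acting on the unprimed points only. *)
Definition move_top (s : 'S_n) p : point n :=
  match p with inl i => inl (s i) | inr j => inr j end.

(** The permutation [s] acting on the primed points only. *)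
Definition move_bottom (s : 'S_n) p : point n :=
  match p with inl i => inl i | inr j => inr (s j) end.

Lemma move_top_inj s : injective (move_top s).
Proof. by move=> [i|i] [j|j] //= [] // /perm_inj->. Qed.

Lemma move_bottomK s : cancel (move_bottom s) (move_bottom s^-1).
Proof. by case=> i //=; rewrite permK. Qed.

(** The unit with blocks {i, (s i)'}. *)
Definition perm_diagram (s : 'S_n) : diagram n := relabel (move_top s) 1.

Lemma perm_brauer s : perm_diagram s \in brauer n.
Proof. by rewrite relabel_brauer ?one_brauer //; apply: move_top_inj. Qed.

Lemma conn_permE s p q : conn (perm_diagram s) p q =
  (index_of (move_top s p) == index_of (move_top s q)).
Proof. by rewrite conn_relabel conn1. Qed.

Lemma conn_perm s i j : conn (perm_diagram s) (inl i) (inr j) = (s i == j).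
Proof. by rewrite conn_permE. Qed.

Lemma mul_perm a s : a * perm_diagram s = relabel (move_bottom s^-1) a.
Proof.
pose g (x : point3 n) : point n := match x with
  inl p => p | inr j => inr (s j) end.
have gu p : g (upper p) = move_bottom s p by case: p.
have gl p : g (lower p) = inr (index_of (move_top s p)) by case: p.
apply: (@mul_eq _ _ _ g) => // p q.
- by rewrite conn_relabel !gu !move_bottomK.
- by rewrite conn_permE !gl => /eqP e; rewrite conn_relabel e conn_refl.
have up r : connect (stack a (perm_diagram s)) (inl r) (upper (move_bottom s^-1 r)).
  case: r => j /=; first exact: connect0.
  rewrite stack_connect_sym.
  apply: (@stack_lower a (perm_diagram s) (inl _) (inr j)).
  by rewrite conn_perm permKV.
rewrite conn_relabel => /(@stack_upper a (perm_diagram s)) h.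
by apply: (connect_trans (up p)); rewrite stack_connect_sym;
   apply: (connect_trans (up q)); rewrite stack_connect_sym.
Qed.

Lemma perm_diagramM s t : perm_diagram (s * t) = perm_diagram s * perm_diagram t.
Proof.
rewrite mul_perm; apply: diagram_eq => p q; rewrite !conn_relabel !conn1.
have e r : index_of (move_top (s * t) r)
         = t (index_of (move_top s (move_bottom t^-1 r))).
  by case: r => i /=; rewrite ?permM ?permKV.
by rewrite !e (inj_eq perm_inj).
Qed.

Lemma perm_diagram1 : perm_diagram 1 = 1.
Proof.
apply: diagram_eq => p q; rewrite conn_relabel.
by congr conn; [case: p|case: q] => i //=; rewrite perm1.
Qed.

Lemma perm_diagram_inj : injective perm_diagram.
Proof.
move=> s t e; apply/permP => i; apply/eqP.
by rewrite eq_sym -conn_perm -e conn_perm.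
Qed.

Lemma perm_diagramVK s a : perm_diagram s^-1 * (perm_diagram s * a) = a.
Proof. by rewrite mulgA -perm_diagramM mulVg perm_diagram1 mul1g. Qed.

Lemma horiz_perm u s : horiz u (perm_diagram s) = set0.
Proof.
apply/setP => i; rewrite in_set0; apply/negP => /horizP[j ji].
rewrite conn_relabel conn1; case: u => /=; rewrite ?(inj_eq perm_inj);
by rewrite eq_sym (negPf ji).
Qed.

Lemma horiz0_perm u a : a \in brauer n -> horiz u a = set0 ->
  exists s, a = perm_diagram s.
Proof.
move=> Ba h0; have {u h0}h0 : horiz true a = set0.
  by apply/eqP; rewrite -cards_eq0 (card_horiz true u) // h0 cards0.
pose f i := index_of (partner a (inl i)).
have fE i : partner a (inl i) = inr (f i).
  by have [] := @horiz_partner true a i Ba; rewrite ?h0 ?inE // /f => j /= ->.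
have f_inj : injective f.
  move=> i j e; apply/eqP; have : i \notin horiz true a by rewrite h0 inE.
  apply: contraNT => ij; apply/horizP; exists j; first by rewrite eq_sym.
  apply: (@conn_trans a (inr (f i))); first by rewrite -fE conn_partner.
  by rewrite conn_sym e -fE conn_partner.
exists (perm f_inj); apply/esym/brauer_eq => //; first exact: perm_brauer.
have c i : conn a (inl i) (inr (f i)) by rewrite -fE conn_partner.
have c' r : conn a r (inr (index_of (move_top (perm f_inj) r))).
  by case: r => i /=; rewrite ?permE ?conn_refl ?c.
move=> p q; rewrite conn_relabel conn1 => /eqP e.
by apply: conn_trans (c' p) _; rewrite e conn_sym c'.
Qed.

Lemma unitsP a :
  reflect (exists s, a = perm_diagram s) (a \in brauer_units n).
Proof.
rewrite inE; apply: (iffP forall_inP) => [h|[s -> B aB]].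
  apply: (@horiz0_perm true).
    rewrite inE; apply/forall_inP => B /h /existsP[i /existsP[j /eqP->]].
    by rewrite cards2.
  apply/setP => i; rewrite in_set0; apply/negP => /horizP[j ji c].
  have aB := pblock_blocks a (inl i).
  have /existsP[i' /existsP[j' /eqP e]] := h _ aB.
  have := conn_refl a (inl i); rewrite /conn e !inE orbF => /eqP[ei].
  move: c; rewrite /conn e !inE orbF -ei => /eqP[ej].
  by rewrite ej eqxx in ji.
have B2 := perm_brauer s.
have /and3P[_ tI B0] := blocksP (perm_diagram s).
have [p pB] : exists p, p \in B.
  by apply/set0Pn; apply: contraNneq B0 => <-.
pose i := s^-1 (index_of (move_top s p)).
have c : conn (perm_diagram s) p (inl i).
  by rewrite conn_relabel conn1 /= permKV.
have iB : inl i \in B by rewrite -(conn_in_block _ aB pB).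
apply/existsP; exists i; apply/existsP; exists (s i).
apply/eqP/setP => q; rewrite -(conn_in_block _ aB iB) connE // !inE.
by rewrite (@partner_eq _ _ (inr (s i))) // conn_perm.
Qed.

Lemma units_brauer : brauer_units n \subset brauer n.
Proof. by apply/subsetP => a /unitsP[s ->]; apply: perm_brauer. Qed.

Lemma units_horiz u a : a \in brauer n ->
  (a \in brauer_units n) = (horiz u a == set0).
Proof.
move=> Ba; apply/unitsP/eqP => [[s ->]|]; first exact: horiz_perm.
exact: horiz0_perm.
Qed.

(** For [k != l], the diagram with blocks {k, l}, {k', l'} and {m, m'} for all
    other m: exchanging l and k' in the identity produces it. *)
Definition hook k l : diagram n := relabel (tperm (inl l) (inr k)) 1.

Lemma hook_brauer k l : hook k l \in brauer n.
Proof. by rewrite relabel_brauer ?one_brauer //; apply: perm_inj. Qed.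

(** Let x and y be the partners of k' and l' in [a].  The blocks {k', x} and
    {l', y} of [a] are replaced in the product by {x, y} and {k', l'}, and
    exchanging x and l' in [a] gives just that.  If k' and l' are partners, then
    x = l' and the product is [a]. *)
Lemma mul_hook a k l : a \in brauer n -> k != l ->
  a * hook k l = relabel (tperm (partner a (inr k)) (inr l)) a.
Proof.
move=> Ba kl; set x := partner a (inr k); set t := tperm x (inr l).
have xk : x != inr k by apply: partnerN.
have lk : (inr l : point n) != inr k by rewrite eq_sym.
have axk : conn a x (inr k) by rewrite conn_sym conn_partner.
have tk : t (inr k) = inr k by rewrite tpermD.
pose kls : {set point n} := [set inr k; inr l].
have hkl : conn (hook k l) (inr k) (inr l).
  by rewrite conn_relabel conn1 tpermR tpermD.
have hkl' : conn (hook k l) (inl k) (inl l).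
  by rewrite conn_relabel conn1 tpermL tpermD //= (inj_eq inl_inj) eq_sym.
have hm m : inr m \notin kls -> conn (hook k l) (inl m) (inr m).
  rewrite !inE => /norP[mk ml]; rewrite conn_relabel conn1 !tpermD //.
    by rewrite eq_sym.
  by rewrite eq_sym.
(* The pair [kls] of bottom points is a block of the product. *)
have ckl p q : conn (relabel t a) p q -> p \in kls -> q \in kls.
  suff ck : conn (relabel t a) (inr k) =1 mem kls.
    move=> pq; rewrite -![_ \in kls]/(mem kls _) -!ck => /conn_trans; exact.
  have ckl : conn (relabel t a) (inr k) (inr l).
    by rewrite conn_relabel tk tpermR conn_partner.
  have Bt : relabel t a \in brauer n by rewrite relabel_brauer //; apply: perm_inj.
  by move=> r; rewrite connE // (partner_eq _ ckl) //= !inE.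
(* The vertices k'' and l'' get the label x.  If x = l' they form a component
   without any top or bottom point, and any common label would do. *)
pose g (y : point3 n) : point n := match y with
  inl p => p | inr m => if inr m \in kls then x else inr m end.
have gu p : g (upper p) = if p \in kls then x else p.
  by case: p => j //=; rewrite !inE.
apply: (@mul_eq _ _ _ g) => // p q.
- move=> pq; rewrite !gu; pose D : {set point n} := [set x; inr k].
  have aD r : conn a x r = (r \in D).
    by rewrite connE // (partner_eq Ba axk) ?inE // eq_sym.
  (* D is the block {x, k'} of [a]; away from it, [g] composed with [upper]
     is [t]. *)
  have [pD|pD] := boolP (p \in D).
    have qD : q \in D.
      by rewrite -aD; apply: conn_trans pq; rewrite aD.
    have gD r : r \in D -> (if r \in kls then x else r) = x.
      by rewrite !inE => /orP[] /eqP->; rewrite ?eqxx //; case: ifP.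
    by rewrite !gD // conn_refl.
  have qD : q \notin D.
    by apply: contra pD; rewrite -!aD => /conn_trans -> //; rewrite conn_sym.
  have gD r : r \notin D -> (if r \in kls then x else r) = t r.
    rewrite !inE => /norP[rx rk]; rewrite (negPf rk) /=.
    have [->|rl] := eqVneq r (inr l); first by rewrite tpermR.
    by rewrite tpermD // eq_sym.
  by rewrite !gD // conn_relabel !tpermK.
- have Bh := hook_brauer k l; rewrite connE // => /orP[/eqP->|/eqP->].
    exact: conn_refl.
  case: p => m /=.
    have [mK|mK] := boolP (inr m \in kls); last first.
      rewrite (partner_eq Bh (hm _ mK)) //= ?(negPf mK);
      exact: conn_refl.
    move: mK; rewrite !inE => /orP[] /eqP[->].
      rewrite (partner_eq Bh hkl') ?(inj_eq inl_inj) 1?eq_sym //= !inE eqxx orbT.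
      exact: conn_refl.
    rewrite (partner_eq Bh (q := inl k)) 1?conn_sym ?(inj_eq inl_inj) //=.
    by rewrite !inE eqxx conn_refl.
  have [mK|mK] := boolP (inr m \in kls); last first.
    rewrite (partner_eq Bh (q := inl m)) 1?conn_sym ?hm //= ?(negPf mK);
      exact: conn_refl.
  move: mK; rewrite !inE => /orP[] /eqP[->].
    by rewrite (partner_eq Bh hkl) //= conn_relabel tk tpermR conn_partner.
  rewrite (partner_eq Bh (q := inr k)) 1?conn_sym // 1?eq_sym //=.
  by rewrite conn_relabel tk tpermR conn_partner.
move=> pq; have [pK|pK] := boolP (p \in kls).
  have := ckl _ _ pq pK; move: pK; rewrite !inE.
  move=> /orP[] /eqP-> /orP[] /eqP->; rewrite ?connect0 //;
    last rewrite stack_connect_sym; exact: (stack_lower _ hkl).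
have qK : q \notin kls.
  by apply: contra pK; apply: ckl; rewrite conn_sym.
have up r : r \notin kls -> connect (stack a (hook k l)) (inl r) (upper r).
  case: r => m // rK; rewrite stack_connect_sym; exact: (stack_lower _ (hm _ rK)).
(* For r = x the path passes from k'' to l'' along the upper block of the
   hook. *)
have upt r : r \notin kls -> connect (stack a (hook k l)) (inl r) (upper (t r)).
  move=> rK; have [e|rx] := eqVneq r x.
    apply: connect_trans (up _ rK) _; rewrite e tpermL.
    apply: connect_trans (stack_upper _ axk) _.
    exact: (stack_lower _ hkl').
  by move: (rK); rewrite !inE => /norP[_ rl]; rewrite tpermD ?up // eq_sym.
apply: connect_trans (upt _ pK) _; rewrite stack_connect_sym.
apply: connect_trans (upt _ qK) _; rewrite stack_connect_sym.
by apply: stack_upper; rewrite -conn_relabel.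
Qed.
End Diagrams.

Section BrauerMonoid.
Variable n : nat.
Implicit Types (a b c : diagram n) (p q : point n) (i j k l : 'I_n).

(** * Generators of the Brauer monoid *)

(** Exchanging i and l' turns the blocks {i, j}, {k', l'} of [a] into {i, k'},
    {j, l'}; multiplying the result by the hook gives back [a]. *)
Lemma split_hook a k l : a \in brauer n -> k != l -> conn a (inr k) (inr l) ->
  exists b, [/\ b \in brauer n, a = b * hook k l
              & #|horiz true b| + 2 <= #|horiz true a|].
Proof.
move=> Ba kl akl.
have : horiz true a != set0.
  rewrite -cards_eq0 (card_horiz true false) // cards_eq0.
  by apply/set0Pn; exists k; apply/horizP; exists l; rewrite 1?eq_sym.
case/set0Pn => i /[dup] ia /horizP[j ji /= aij].
set t := tperm (inl i) (inr l); pose b := relabel t a.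
have Bb : b \in brauer n by rewrite relabel_brauer //; apply: perm_inj.
have tk : t (inr k) = inr k by rewrite tpermD // (inj_eq inr_inj) eq_sym.
have tj : t (inl j) = inl j by rewrite tpermD // (inj_eq inl_inj) eq_sym.
have bk : partner b (inr k) = inl i.
  by apply: partner_eq; rewrite // conn_relabel tpermL tk.
exists b; split=> //.
  rewrite mul_hook // bk; apply: diagram_eq => p q.
  by rewrite !conn_relabel !tpermK.
have bN m r : conn b (inl m) (inr r) -> m \notin horiz true b.
  move=> c; apply/negP => /horizP[m' m'm c'].
  by have := partner_eq Bb c' m'm; rewrite (partner_eq Bb c).
have bi : i \notin horiz true b.
  by apply: (bN _ k); rewrite conn_sym -bk conn_partner.
have bj : j \notin horiz true b.
  by apply: (bN _ l); rewrite conn_relabel tj tpermR conn_sym.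
have ja : j \in horiz true a.
  by apply/horizP; exists i; rewrite 1?eq_sym // conn_sym.
suff s : horiz true b \subset horiz true a :\: [set i; j].
  have := cardsID [set i; j] (horiz true a).
  rewrite (setIidPr _) ?cards2 1?[i == j]eq_sym ?ji.
    by have := subset_leq_card s => sb <-; rewrite addnC leq_add2l.
  by apply/subsetP => m; rewrite in_set2 => /orP[] /eqP->.
apply/subsetP => m /[dup] mb /horizP[r rm c].
have rb : r \in horiz true b.
  by apply/horizP; exists m; rewrite 1?eq_sym // conn_sym.
have mi : m != i by apply: contraNneq bi => <-.
have ri : r != i by apply: contraNneq bi => <-.
rewrite in_setD in_set2 (negPf mi) /=; apply/andP; split.
  by apply: contraNneq bj => <-.
apply/horizP; exists r => //.
by move: c; rewrite conn_relabel !tpermD // (inj_eq inl_inj) eq_sym.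
Qed.

Lemma mul_stableP (M : {set diagram n}) :
  reflect {in M &, forall x y, x * y \in M} (mul_stable M).
Proof.
apply: (iffP forall_inP) => [h x y xM yM | h x xM]; last first.
  by apply/forall_inP => y; apply: h.
by have /forall_inP := h x xM; apply.
Qed.

(** Permutation diagrams and hooks generate the Brauer monoid. *)
Lemma brauer_hook_ind (P : diagram n -> Prop) :
  (forall s, P (perm_diagram s)) ->
  (forall a k l, a \in brauer n -> k != l -> P a -> P (a * hook k l)) ->
  forall a, a \in brauer n -> P a.
Proof.
move=> P1 PM a; have [m] := ubnP #|horiz true a|; elim: m a => // m IH a am Ba.
have [h0|] := eqVneq (horiz false a) set0.
  by have [s ->] := horiz0_perm Ba h0.
case/set0Pn => k /horizP[l lk akl].
have kl : k != l by rewrite eq_sym.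
have [b [Bb e lt]] := split_hook Ba kl akl.
rewrite e; apply: PM => //; apply: IH => //; lia.
Qed.

Lemma brauerM a b : a \in brauer n -> b \in brauer n -> a * b \in brauer n.
Proof.
move=> Ba Bb; move: b Bb a Ba.
apply: brauer_hook_ind => [s|b k l Bb kl IH] a Ba.
  by rewrite mul_perm relabel_brauer //; apply/can_inj/move_bottomK.
rewrite mulgA mul_hook ?IH // relabel_brauer ?IH //; exact: perm_inj.
Qed.

(** The non-units form an ideal. *)
Lemma unit_mulP a b : a \in brauer n -> b \in brauer n ->
  (a * b \in brauer_units n) = (a \in brauer_units n) && (b \in brauer_units n).
Proof.
move=> Ba Bb; apply/idP/andP => [u|[/unitsP[s ->] /unitsP[t ->]]]; last first.
  by apply/unitsP; exists (s * t); rewrite perm_diagramM.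
have Bab := brauerM Ba Bb; split.
  rewrite (units_horiz true) // -subset0; apply: subset_trans (horiz_mul_up a b) _.
  by rewrite subset0 -units_horiz.
rewrite (units_horiz false) // -subset0; apply: subset_trans (horiz_mul_lo a b) _.
by rewrite subset0 -units_horiz.
Qed.

Lemma units_mul a b : a \in brauer_units n -> b \in brauer_units n ->
  a * b \in brauer_units n.
Proof.
have /subsetP s := units_brauer n.
by move=> Ua Ub; rewrite unit_mulP ?Ua ?s.
Qed.

Lemma one_unit : (1 : diagram n) \in brauer_units n.
Proof. by apply/unitsP; exists 1; rewrite perm_diagram1. Qed.

Lemma unit_inv a : a \in brauer_units n ->
  exists2 b, b \in brauer_units n & a * b = 1 /\ b * a = 1.
Proof.
case/unitsP => s ->; exists (perm_diagram s^-1); first by apply/unitsP; exists s^-1.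
by rewrite -!perm_diagramM mulgV mulVg perm_diagram1.
Qed.

(** * Diagrams of rank n - 2 *)

(** The Brauer diagrams of rank n - 2. *)
Definition corank2 : {set diagram n} := [set a in brauer n | diagram_rank a == n - 2].

Lemma corank2E u a : 2 <= n ->
  (a \in corank2) = (a \in brauer n) && (#|horiz u a| == 2).
Proof.
move=> n2; rewrite inE; case: (boolP (a \in _)) => //= Ba.
have := rank_horiz u Ba; move: (diagram_rank a) #|_| => r h e.
by apply/eqP/eqP => ?; lia.
Qed.

(** In particular, no Brauer diagram has rank n - 1. *)
Lemma horiz_gt1 u a : a \in brauer n -> horiz u a != set0 -> 1 < #|horiz u a|.
Proof.
move=> Ba /set0Pn[i /[dup] hi /horizP[j ji c]].
apply/card_gt1P; exists i, j; split=> //; last by rewrite eq_sym.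
by apply/horizP; exists i; rewrite 1?eq_sym // conn_sym.
Qed.

Lemma two_transitive i j k l : i != j -> k != l ->
  exists s : 'S_n, s i = k /\ s j = l.
Proof.
move=> ij kl; pose s := tperm i k; exists (s * tperm (s j) l).
have sj : s j != k by rewrite -[X in _ != X](tpermL i k) (inj_eq perm_inj) eq_sym.
by rewrite !permM [s i]tpermL tpermL tpermD 1?[l == k]eq_sym.
Qed.

Hypothesis n_ge2 : 2 <= n.

(** [split_hook] with a left factor that has no non-transverse block left. *)
Lemma corank2_unitl a k l : a \in corank2 -> k != l -> conn a (inr k) (inr l) ->
  exists s, a = perm_diagram s * hook k l.
Proof.
rewrite (corank2E true) // => /andP[Ba /eqP h2] kl akl.
have [b [Bb e lt]] := split_hook Ba kl akl.
have [] := horiz0_perm (u := true) Bb; last by move=> s es; exists s; rewrite e es.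
by apply/eqP; rewrite -cards_eq0; lia.
Qed.

Lemma corank2_hook a k l : a \in corank2 -> k != l ->
  exists s t, hook k l = perm_diagram s * a * perm_diagram t.
Proof.
move=> /[dup] aC; rewrite (corank2E false) // => /andP[Ba /eqP h2] kl.
have /set0Pn[k1 /horizP[l1 lk1 c]] : horiz false a != set0.
  by rewrite -cards_eq0 h2.
have [||t [tk tl]] := @two_transitive k1 l1 k l => //; first by rewrite eq_sym.
have Bt : a * perm_diagram t \in brauer n by rewrite brauerM ?perm_brauer.
have [|||s e] := @corank2_unitl (a * perm_diagram t) k l.
- rewrite (corank2E true) // Bt /= -(_ : #|horiz true a| = 2).
    apply/eqP/eq_card => i; rewrite !inE mul_perm; apply: eq_existsb => j.
    by rewrite conn_relabel.
  by rewrite -h2 (card_horiz true false).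
- by [].
- by rewrite mul_perm conn_relabel /= -tk -tl !permK.
exists s^-1, t; rewrite -mulgA e perm_diagramVK //.
Qed.

Lemma corank2_equiv a b : a \in corank2 -> b \in corank2 ->
  exists s t, a = perm_diagram s * b * perm_diagram t.
Proof.
move=> aC bC; have := aC; rewrite (corank2E false) // => /andP[Ba /eqP h2].
have /set0Pn[k /horizP[l lk c]] : horiz false a != set0.
  by rewrite -cards_eq0 h2.
have kl : k != l by rewrite eq_sym.
have [s ->] := corank2_unitl aC kl c.
have [s' [t ->]] := corank2_hook bC kl.
by exists (s * s'), t; rewrite perm_diagramM !mulgA.
Qed.

Lemma hook_idem k l : k != l -> hook k l * hook k l = hook k l.
Proof.
move=> kl; rewrite mul_hook ?hook_brauer //.
rewrite (partner_eq (q := inr l)) ?hook_brauer //.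
- by apply: diagram_eq => p q; rewrite conn_relabel tperm1 !perm1.
- by rewrite conn_relabel conn1 tpermR tpermD // (inj_eq inr_inj) eq_sym.
- by rewrite (inj_eq inr_inj) eq_sym.
Qed.

Lemma hook_corank2 k l : k != l -> hook k l \in corank2.
Proof.
move=> kl; rewrite (corank2E true) // hook_brauer /=.
suff -> : horiz true (hook k l) = [set k; l] by rewrite cards2 kl.
have c : conn (hook k l) (inl k) (inl l).
  by rewrite conn_relabel conn1 tpermL tpermD // (inj_eq inl_inj) eq_sym.
apply/setP => i; rewrite !inE; apply/existsP/orP => [[j /andP[ji]]|].
  rewrite conn_relabel conn1 /=.
  have tE m : index_of (tperm (inl l) (inr k) (inl m)) = if m == l then k else m.
    have [->|ml] := eqVneq m l; first by rewrite tpermL.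
    by rewrite tpermD // (inj_eq inl_inj) eq_sym.
  rewrite !tE; case: (eqVneq i l); first by right.
  by case: (eqVneq j l) => _ _ // /eqP e; left; [apply/eqP|rewrite e eqxx in ji].
case=> /eqP->; [exists l|exists k]; rewrite /= 1?eq_sym ?kl //= 1?conn_sym //.
by rewrite eq_sym kl.
Qed.

Lemma corank2_regular a : a \in corank2 -> exists2 b, b \in brauer n & a * b * a = a.
Proof.
move=> aC; have := aC; rewrite (corank2E false) // => /andP[Ba /eqP h2].
have /set0Pn[k /horizP[l lk c]] : horiz false a != set0.
  by rewrite -cards_eq0 h2.
have kl : k != l by rewrite eq_sym.
have [s ->] := corank2_unitl aC kl c.
exists (perm_diagram s^-1); first exact: perm_brauer.
by rewrite -2!mulgA perm_diagramVK hook_idem.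
Qed.

(** The units and one diagram of rank n - 2 generate the Brauer monoid. *)
Lemma brauer_generated (M : {set diagram n}) a :
  mul_stable M -> brauer_units n \subset M -> a \in corank2 -> a \in M ->
  brauer n \subset M.
Proof.
move=> /mul_stableP MM /subsetP UM aC aM.
have PM s : perm_diagram s \in M by apply/UM/unitsP; exists s.
apply/subsetP; apply: brauer_hook_ind => // b k l Bb kl bM.
apply: (MM) => //; have [s [t ->]] := corank2_hook aC kl.
by rewrite !MM ?PM.
Qed.
End BrauerMonoid.

Section Maximal.
Variable n : nat.
Implicit Types (a b c : diagram n) (M N U : {set diagram n}) (A : {set 'S_n}).

Local Notation S := (brauer n).
Local Notation E := (brauer_units n).

(** * Subsemigroups of the group of units *)

(** The union of [U] with the ideal of non-units. *)
Definition with_singular U := (S :\: E) :|: U.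

Lemma subsemigroupP (T M : {set diagram n}) :
  reflect [/\ M != set0, {subset M <= T} & {in M &, forall x y, x * y \in M}]
          (subsemigroup T M).
Proof.
apply: (iffP and3P) => -[M0 sub st]; split=> //; [exact/subsetP|exact/mul_stableP| |];
  [exact/subsetP|exact/mul_stableP].
Qed.

Lemma units_perm : E = perm_diagram (n := n) @: setT.
Proof.
apply/setP => a; apply/unitsP/imsetP => [[s ->]|[s _ ->]]; first by exists s.
by exists s.
Qed.

Lemma perm_diagram_preimK U : U \subset E ->
  perm_diagram (n := n) @: (perm_diagram (n := n) @^-1: U) = U.
Proof.
move=> /subsetP UE; apply/setP => a; apply/imsetP/idP => [[s]|aU].
  by rewrite inE => ? ->.
by have /unitsP[s e] := UE a aU; exists s; rewrite // inE -e.
Qed.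

Lemma subgroup_perm A : subgroup E (perm_diagram (n := n) @: A) = group_set A.
Proof.
have mem s : (perm_diagram s \in perm_diagram (n := n) @: A) = (s \in A).
  exact/mem_imset/perm_diagram_inj.
have sE : perm_diagram (n := n) @: A \subset E.
  by rewrite units_perm; apply/imsetS/subsetT.
apply/idP/idP => [/and4P[_ A1 /mul_stableP AM _]|gA].
  apply/group_setP; split; first by rewrite -mem perm_diagram1.
  by move=> s t sA tA; rewrite -mem perm_diagramM AM // mem.
pose G := Group gA.
apply/and4P; split=> //.
- by rewrite -perm_diagram1 mem; apply: (group1 G).
- apply/mul_stableP => _ _ /imsetP[s sA ->] /imsetP[t tA ->].
  by rewrite -perm_diagramM mem; apply: (groupM (G := G)).
- apply/forall_inP => _ /imsetP[s sA ->]; apply/exists_inP.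
  exists (perm_diagram s^-1); first by rewrite mem; rewrite (groupV G).
  by rewrite -!perm_diagramM mulgV mulVg perm_diagram1 eqxx.
Qed.

(** In a finite group, a nonempty set closed under products is a subgroup. *)
Lemma subsemigroup_units_subgroup U :
  U \subset E -> U != set0 -> {in U &, forall x y, x * y \in U} -> subgroup E U.
Proof.
move=> UE U0 UM; rewrite -(perm_diagram_preimK UE) subgroup_perm.
set A := _ @^-1: U; have AM : {in A &, forall s t, s * t \in A}.
  by move=> s t; rewrite !inE perm_diagramM; apply: UM.
have AX s m : s \in A -> s ^+ m.+1 \in A.
  by move=> sA; elim: m => // m IH; rewrite expgS AM.
have [a aU] := set0Pn _ U0; have /unitsP[s es] := subsetP UE a aU.
apply/group_setP; split=> //.
by rewrite -(expg_order s) -(prednK (order_gt0 s)) AX // inE -es.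
Qed.

Lemma maximal_subgroup_perm (G : {group 'S_n}) :
  maximal_subgroup E (perm_diagram (n := n) @: G) = maximal G [set: 'S_n].
Proof.
pose D := perm_diagram (n := n); have D_inj : injective D := @perm_diagram_inj n.
have subE (A B : {set 'S_n}) : (D @: A \subset D @: B) = (A \subset B).
  apply/idP/idP => [/subsetP h|]; last exact: imsetS.
  by apply/subsetP => s sA; rewrite -(mem_imset _ _ D_inj) h ?mem_imset.
have prE A : (D @: A \proper E) = (A \proper [set: 'S_n]).
  by rewrite units_perm !properE !subE.
apply/maxsetP/maxgroupP => -[].
  move=> /andP[_ pG] mG; split; first by rewrite -prE.
  move=> H pH sGH; apply: (imset_inj D_inj); apply: mG; last exact: imsetS.
  by rewrite subgroup_perm groupP prE.
move=> pG mG; split; first by rewrite subgroup_perm groupP prE.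
move=> V /andP[gV pV] sGV; have /and4P[VE _ _ _] := gV.
move: gV pV sGV; rewrite -(perm_diagram_preimK VE) subgroup_perm => gV.
rewrite prE subE => pV sGV.
by rewrite -(mG (Group gV)).
Qed.

(** * The maximal subsemigroups *)

Lemma with_singularI U : U \subset E -> with_singular U :&: E = U.
Proof.
move=> UE; rewrite setIUl setIDAC setDIl setDv setI0 set0U.
exact/setIidPl.
Qed.

Lemma singular_split M : M \subset S -> S :\: E \subset M ->
  M = with_singular (M :&: E).
Proof.
move=> /subsetP MS /subsetP SEM; apply/setP => a; rewrite in_setU in_setI.
apply/idP/orP => [aM|[/SEM|/andP[]] //].
by rewrite in_setD aM MS //; case: (a \in E); [right|left].
Qed.

Lemma with_singularM U : U \subset E -> {in U &, forall x y, x * y \in U} ->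
  {in with_singular U &, forall x y, x * y \in with_singular U}.
Proof.
move=> /subsetP UE UM x y; have /subsetP ES := units_brauer n.
have inS z : z \in with_singular U -> z \in S.
  by rewrite in_setU in_setD => /orP[/andP[]|/UE/ES].
move=> xU yU; have [xS yS] := (inS _ xU, inS _ yU).
have xyS := brauerM xS yS; rewrite in_setU in_setD xyS andbT.
case: (boolP (_ \in E)) => //=; rewrite unit_mulP // => /andP[xE yE].
move: xU yU; rewrite !in_setU !in_setD xE yE /=; exact: UM.
Qed.

Lemma with_singular_proper U : U \proper E -> with_singular U \proper S.
Proof.
case/properP => UE [a aE aU]; apply/properP; split.
  by rewrite subUset subsetDl (subset_trans UE (units_brauer n)).
exists a; first exact: subsetP (units_brauer n) a aE.
by rewrite in_setU in_setD aE.
Qed.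

Lemma maximal_with_singular U :
  maximal_subgroup E U -> maximal_subsemigroup S (with_singular U).
Proof.
case/maxsetP => /andP[/and4P[UE U1 /mul_stableP UM _] pU] mU.
apply/maxsetP; split.
  rewrite with_singular_proper // andbT; apply/subsemigroupP; split.
  - by apply/set0Pn; exists 1; rewrite inE U1 orbT.
  - exact/subsetP/proper_sub/with_singular_proper.
  - exact: with_singularM.
move=> N /andP[/subsemigroupP[_ NS NM] pN] sN.
have SN : S :\: E \subset N by apply: subset_trans sN; apply: subsetUl.
have UN : U \subset N by apply: subset_trans sN; apply: subsetUr.
have e := singular_split (introT subsetP NS) SN.
rewrite e; congr with_singular; apply: mU; last by rewrite subsetI UN.
rewrite subsemigroup_units_subgroup ?subsetIr //=.
- rewrite properEneq subsetIr andbT; apply: contraTneq pN => NE.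
  rewrite properE negb_and negbK; apply/orP; right; apply/subsetP => a aS.
  have [|aE] := boolP (a \in E); first by rewrite -NE => /setIP[].
  by apply: (subsetP SN); rewrite in_setD aE.
- by apply/set0Pn; exists 1; rewrite inE (subsetP UN) // one_unit.
- by move=> x y /setIP[xN xE] /setIP[yN yE]; rewrite inE NM // units_mul.
Qed.

Hypothesis n_ge2 : 2 <= n.

Lemma exists_hook : exists a, a \in corank2 n.
Proof.
pose k := Ordinal (ltnW n_ge2); pose l := Ordinal n_ge2.
by exists (hook k l); apply: hook_corank2.
Qed.

Lemma units_corank2 : E \subset S :\: corank2 n.
Proof.
apply/subsetP => a aE; have aS := subsetP (units_brauer n) a aE.
rewrite in_setD aS (corank2E true) // aS /= andbT.
by move: aE; rewrite (units_horiz true) // => /eqP->; rewrite cards0.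
Qed.

Lemma maximal_corank2 : maximal_subsemigroup S (S :\: corank2 n).
Proof.
have [h hC] := exists_hook.
have hS : h \in S by move: hC; rewrite inE => /andP[].
apply/maxsetP; split.
  apply/andP; split; last first.
    by apply/properP; split; [exact: subsetDl|exists h; rewrite // in_setD hC].
  apply/subsemigroupP; split.
  - by apply/set0Pn; exists 1; rewrite (subsetP units_corank2) // one_unit.
  - by apply/subsetP/subsetDl.
  move=> x y; rewrite !in_setD => /andP[xC xS] /andP[yC yS].
  have xyS := brauerM xS yS; rewrite xyS andbT.
  (* A non-unit outside rank n - 2 has more than two points in [horiz]. *)
  have big u z : z \in S -> z \notin corank2 n -> z \notin E -> 2 < #|horiz u z|.
    move=> zS; rewrite (corank2E u) // zS (units_horiz u) //= => z2 /(horiz_gt1 zS).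
    by rewrite leq_eqVlt eq_sym (negPf z2).
  have [xE|xE] := boolP (x \in E); last first.
    rewrite (corank2E true) // xyS /= gtn_eqF //.
    exact: leq_trans (big true x xS xC xE) (subset_leq_card (horiz_mul_up x y)).
  have [yE|yE] := boolP (y \in E); last first.
    rewrite (corank2E false) // xyS /= gtn_eqF //.
    exact: leq_trans (big false y yS yC yE) (subset_leq_card (horiz_mul_lo x y)).
  by have := subsetP units_corank2 _ (units_mul xE yE); rewrite in_setD => /andP[].
move=> N /andP[/subsemigroupP[_ NS NM] pN] sN; apply/eqP.
rewrite eqEsubset sN andbT; apply/subsetP => a aN.
rewrite in_setD NS // andbT; apply: contraL pN => aC.
rewrite properE negb_and negbK; apply/orP; right.
apply: (brauer_generated n_ge2 _ _ aC aN); first exact/mul_stableP.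
exact: subset_trans units_corank2 sN.
Qed.

(** Every maximal subsemigroup is of one of the two kinds. *)
Lemma maximal_cases M : maximal_subsemigroup S M ->
  (exists2 U, maximal_subgroup E U & M = with_singular U) \/
  M = S :\: corank2 n.
Proof.
case/maxsetP => /andP[/subsemigroupP[M0 MS MM] pM] mM.
have sMS : M \subset S by apply/subsetP.
have [EM|EM] := boolP (E \subset M); [right|left].
  have /maxsetP[/andP[sC pC] _] := maximal_corank2.
  rewrite [RHS]mM ?sC //; apply/subsetP => a aM; rewrite in_setD MS // andbT.
  apply: contraL pM => aC; rewrite properE negb_and negbK; apply/orP; right.
  by apply: (brauer_generated n_ge2 _ EM aC aM); apply/mul_stableP.
have ME : M :&: E \subset E by apply: subsetIr.
have pME : M :&: E \proper E.
  by rewrite properEneq ME andbT; apply: contra EM => /eqP/setIidPr.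
have sM : M \subset with_singular (M :&: E).
  apply/subsetP => a aM; rewrite in_setU in_setD in_setI aM MS //.
  by case: (a \in E).
have MEM : {in M :&: E &, forall x y, x * y \in M :&: E}.
  by move=> x y /setIP[xM xE] /setIP[yM yE]; rewrite inE MM // units_mul.
have eM : with_singular (M :&: E) = M.
  apply: mM => //; rewrite with_singular_proper // andbT.
  apply/subsemigroupP; split; last exact: with_singularM.
    apply: contraNneq M0 => e; by rewrite -subset0 -e.
  exact/subsetP/proper_sub/with_singular_proper.
have SM : S :\: E \subset M by rewrite -eM subsetUl.
have ME0 : M :&: E != set0.
  (* Otherwise the identity could be added to M; since S_n is not trivial,
     this would give a larger proper subsemigroup. *)
  apply/eqP => ME0; have E1 := one_unit n.
  have pE1 : [set (1 : diagram n)] \proper E.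
    apply/properP; split; first by rewrite sub1set.
    pose k := Ordinal (ltnW n_ge2); pose l := Ordinal n_ge2.
    exists (perm_diagram (tperm k l)); first by apply/unitsP; eexists.
    rewrite inE -perm_diagram1 (inj_eq (@perm_diagram_inj n)).
    by apply/eqP => /permP/(_ k); rewrite tpermL perm1.
  have : 1 \in M :&: E.
    rewrite in_setI E1 andbT (_ : M = with_singular [set (1 : diagram n)]) ?inE ?eqxx ?orbT //.
    apply/esym/mM; last by rewrite -eM ME0 setUS ?sub0set.
    rewrite with_singular_proper // andbT; apply/subsemigroupP; split.
    - by apply/set0Pn; exists 1; rewrite !inE eqxx orbT.
    - exact/subsetP/proper_sub/with_singular_proper.
    - apply: with_singularM; first exact: proper_sub.
      by move=> x y /set1P-> /set1P->; rewrite mulg1 set11.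
  by rewrite ME0 inE.
exists (M :&: E) => //; apply/maxsetP; split.
  by rewrite pME andbT subsemigroup_units_subgroup.
move=> V /andP[/and4P[VE V1 /mul_stableP VM _] pV] sV.
rewrite -(with_singularI VE) (_ : with_singular V = M) //.
apply: mM; last by rewrite -eM setUS.
rewrite with_singular_proper // andbT; apply/subsemigroupP; split.
- by apply/set0Pn; exists 1; rewrite inE V1 orbT.
- exact/subsetP/proper_sub/with_singular_proper.
- exact: with_singularM.
Qed.

(** * Green's relations and the types of the maximal subsemigroups *)

Lemma greenJP a b : a \in S -> b \in S ->
  reflect ((exists s t, [/\ s \in S, t \in S & a = s * b * t]) /\
           (exists s t, [/\ s \in S, t \in S & b = s * a * t]))
          (greenJ S a b).
Proof.
move=> aS bS; have S1 := one_brauer n.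
have sub x y : x \in S -> y \in S ->
  reflect (exists s t, [/\ s \in S, t \in S & x = s * y * t])
   ([set s * x * t | s : diagram n in S, t : diagram n in S]
    \subset [set s * y * t | s : diagram n in S, t : diagram n in S]).
  move=> xS yS; apply: (iffP subsetP) => [/(_ x) h|[s [t [sS tS ->]]]].
    have /imset2P[s t sS tS e] : x 
        \in [set s * y * t | s : diagram n in S, t : diagram n in S].
      by apply: h; apply/imset2P; exists 1 1; rewrite // mul1g mulg1.
    by exists s, t.
  move=> _ /imset2P[s' t' sS' tS' ->].
  by apply/imset2P; exists (s' * s) (t * t'); rewrite ?brauerM // !mulgA.
rewrite /greenJ eqEsubset.
apply: (iffP andP) => [[/(sub _ _ aS bS) ab /(sub _ _ bS aS) ba]|[ab ba]] //.
by split; [exact/sub|exact/sub].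
Qed.

Lemma J_class_mem a : a \in S ->
  [set b in S | greenJ S a b] \in J_classes S.
Proof. by move=> aS; apply/imsetP; exists a. Qed.

Lemma J_class_units : E \in J_classes S.
Proof.
have S1 := one_brauer n; have /subsetP ES := units_brauer n.
suff -> : E = [set b in S | greenJ S 1 b] by apply: J_class_mem.
apply/setP => a; apply/idP/setIdP => [aE|[aS /(greenJP S1 aS)]].
  split; first exact: ES.
  have [b bE [ab ba]] := unit_inv aE.
  apply/(greenJP S1 (ES _ aE)); split.
    by exists b, 1; rewrite S1 mulg1 ba ES.
  by exists a, 1; rewrite S1 !mulg1 ES.
case=> -[s [t [sS tS e]]] _.
have := one_unit n; rewrite e unit_mulP ?brauerM // unit_mulP //.
by case/andP => /andP[].
Qed.

Lemma J_class_corank2 : corank2 n \in J_classes S.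
Proof.
have [h hC] := exists_hook.
have CS a : a \in corank2 n -> a \in S by rewrite inE => /andP[].
suff -> : corank2 n = [set b in S | greenJ S h b] by apply: J_class_mem; apply: CS.
have hS := CS _ hC.
apply/setP => a; apply/idP/setIdP => [aC|[aS /(greenJP hS aS)]].
  split; first exact: CS.
  apply/(greenJP hS (CS _ aC)); split.
    have [s [t ->]] := corank2_equiv n_ge2 hC aC.
    by exists (perm_diagram s), (perm_diagram t); rewrite !perm_brauer.
  have [s [t ->]] := corank2_equiv n_ge2 aC hC.
  by exists (perm_diagram s), (perm_diagram t); rewrite !perm_brauer.
have le x s t : x \in S -> s \in S -> t \in S ->
    #|horiz true x| <= #|horiz true (s * x * t)|.
  move=> xS sS tS; rewrite (card_horiz true false) //.
  apply: leq_trans (subset_leq_card (horiz_mul_lo s x)) _.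
  rewrite (card_horiz false true (brauerM sS xS)).
  exact: subset_leq_card (horiz_mul_up (s * x) t).
case=> -[s [t [sS tS eh]]] [s' [t' [sS' tS' ea]]].
move: hC; rewrite !(corank2E true) // aS hS /= => /eqP h2.
by rewrite eqn_leq -{1}h2 {1}eh le //= -h2 ea le.
Qed.

Lemma with_singular_M5 U :
  maximal_subgroup E U -> type_M5 S (with_singular U).
Proof.
move=> mU; have /maxsetP[/andP[/and4P[UE U1 _ _] _] _] := mU.
have S1 := one_brauer n; have /subsetP ES := units_brauer n.
exists E; split.
- rewrite /arises_from maximal_with_singular // J_class_units.
  apply/subsetP => a; rewrite in_setD in_setU in_setD negb_or => /andP[/andP[h _] aS].
  by move: h; rewrite aS andbT negbK.
- apply/forall_inP => a /unit_inv[b bE [ab _]]; apply/exists_inP.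
  by exists b; [exact: ES|rewrite ab mul1g].
move=> H /imsetP[x xS ->] /subsetP HE.
have xH : x \in [set y in S | greenH S x y].
  by rewrite inE xS /greenH /greenL /greenR !eqxx.
have [y /ES yS [xy yx]] := unit_inv (HE _ xH).
apply/set0Pn; exists 1; rewrite in_setI in_setU U1 orbT inE S1 /=.
apply/andP; split; apply/eqP/setP => z; apply/imsetP/imsetP => -[s sS ->].
- by exists (s * x); rewrite ?mulg1 ?brauerM.
- by exists (s * y); rewrite ?brauerM //= -mulgA yx.
- by exists (x * s); rewrite ?mul1g ?brauerM.
- by exists (y * s); rewrite ?brauerM //= mulgA xy.
Qed.

Lemma corank2_M1 : type_M1 S (S :\: corank2 n).
Proof.
exists (corank2 n); split.
- rewrite /arises_from maximal_corank2 J_class_corank2 setDDr setDv set0U.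
  exact: subsetIr.
- apply/forall_inP => a /(corank2_regular n_ge2)[b bS e].
  by apply/exists_inP; exists b; rewrite ?e.
- by rewrite setIDAC setDIl setDv setI0.
Qed.

(** * Counting the maximal subsemigroups *)

Lemma card_maximal_subgroups :
  #|[set U | maximal_subgroup E U]| = num_maximal_subgroups_Sym n.
Proof.
pose F (G : {group 'S_n}) := perm_diagram (n := n) @: G.
have F_inj : injective F.
  by move=> G H /(imset_inj (@perm_diagram_inj n)) e; apply/val_inj.
rewrite /num_maximal_subgroups_Sym -(card_imset _ F_inj).
apply: eq_card => U; rewrite inE; apply/idP/imsetP => [mU|[G]].
  have /maxsetP[/andP[gU _] _] := mU; have /and4P[UE _ _ _] := gU.
  have e := perm_diagram_preimK UE.
  move: gU; rewrite -{1}e subgroup_perm => gU; exists (Group gU).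
    by rewrite inE -maximal_subgroup_perm /= e.
  by rewrite /F /= e.
by rewrite inE => mG ->; rewrite maximal_subgroup_perm.
Qed.

Lemma card_maximal_subsemigroups :
  #|[set M | maximal_subsemigroup S M]| = num_maximal_subgroups_Sym n + 1.
Proof.
have sub U : maximal_subgroup E U -> U \subset E.
  by case/maxsetP => /andP[/and4P[]].
have -> : [set M | maximal_subsemigroup S M] =
    (S :\: corank2 n) |: with_singular @: [set U | maximal_subgroup E U].
  apply/setP => M; rewrite in_setU1 inE; apply/idP/orP.
    case/maximal_cases => [[U mU ->]|->]; [right|by left].
    by apply/imset_f; rewrite inE.
  case=> [/eqP->|/imsetP[U]]; first exact: maximal_corank2.
  by rewrite inE => mU ->; apply: maximal_with_singular.
rewrite cardsU1 addnC -card_maximal_subgroups; congr (_ + _).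
  apply: card_in_imset => U V; rewrite !inE => /sub UE /sub VE e.
  by rewrite -(with_singularI UE) e with_singularI.
suff -> : S :\: corank2 n \notin with_singular @: [set U | maximal_subgroup E U] by [].
apply/imsetP => -[U]; rewrite inE => mU e.
have /maxsetP[/andP[_ pU] _] := mU.
have := units_corank2; rewrite e => /setIidPr; rewrite with_singularI ?sub // => eU.
by rewrite eU properxx in pU.
Qed.
End Maximal.

Theorem theorem4p4 (n : nat) (n_ge2 : 2 <= n) :
  [/\ forall M : {set diagram n},
        maximal_subsemigroup (brauer n) M <->
        (exists2 U : {set diagram n},
           maximal_subgroup (brauer_units n) U &
           M = (brauer n :\: brauer_units n) :|: U)
        \/ M = brauer n :\: [set a in brauer n | diagram_rank a == n - 2],
      forall U : {set diagram n},
        maximal_subgroup (brauer_units n) U ->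
        type_M5 (brauer n) ((brauer n :\: brauer_units n) :|: U),
      type_M1 (brauer n) (brauer n :\: [set a in brauer n | diagram_rank a == n - 2])
    & #|[set M : {set diagram n} | maximal_subsemigroup (brauer n) M]|
      = num_maximal_subgroups_Sym n + 1].
Proof.
split.
- move=> M; split; first exact: maximal_cases.
  by case=> [[U mU ->]|->]; [exact: maximal_with_singular|exact: maximal_corank2].
- exact: with_singular_M5.
- exact: corank2_M1.
- exact: card_maximal_subsemigroups.
Qed.
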